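(* Let $(X,d,\delta)$ be a dilatation structure, and let $\Sigma^x_\varepsilon(u,v)=\delta^x_{\varepsilon^{-1}}\,\delta_\varepsilon^{\delta^x_\varepsilon u}\,v$. If for any $x$ the distance $d^x$ is non-degenerate, then there exists $C>0$ such that for any $x$ and $u$ with $d(x,u)\le C$ there exists a $d^x$-isometry $\Sigma^x(u,\cdot)$ obtained as the limit $$\lim_{\varepsilon\to0}\Sigma^x_\varepsilon(u,v)=\Sigma^x(u,v),$$ uniformly with respect to $x,u,v$ in compact sets.
   Context: **Parameters.** $\Gamma$ is a Hausdorff topological commutative group, written multiplicatively with neutral element $1$, with a continuous group morphism $\nu:\Gamma\to(0,+\infty)$ (multiplicative group) such that $\inf\nu(\Gamma)=0$; the basic case is $\Gamma=(0,+\infty)$, $\nu=\mathrm{id}$. $\Gamma_1=\nu^{-1}((0,1])$. ''$\varepsilon\to0$'' means $\nu(\varepsilon)\to0$; an element $0$ is adjoined to $\Gamma$ with neighbourhoods generated by $\nu^{-1}((0,a))\cup\{0\}$, $a>0$. $\mathcal O(\varepsilon)$ denotes a positive function tending to $0$ as $\varepsilon\to0$. **Dilatation structure.** $(X,d)$ is a complete, locally compact metric space (small balls are compact); $B_d(x,r)$, $\bar B_d(x,r)$ are open and closed balls. $(X,d,\delta)$ is a dilatation structure if: A0. There are constants $A>1$ and $B$. For $\varepsilon\in\Gamma_1$, $x\in X$, the dilatation $\delta^x_\varepsilon:U(x)\to V_\varepsilon(x)$ is a homeomorphism, $\bar B_d(x,A)\subset U(x)$, and for $\nu(\varepsilon)<1$: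 $B_d(x,\nu(\varepsilon))\subset\delta^x_\varepsilon B_d(x,A)\subset V_\varepsilon(x)\subset U(x)$. For $\nu(\varepsilon)>1$, $\delta^x_\varepsilon:W_\varepsilon(x)\to B_d(x,B)$ is injective, continuous, with continuous inverse on its image, $W_\varepsilon(x)$ is open, $V_{\varepsilon^{-1}}(x)\subset W_\varepsilon(x)$, and $\delta^x_{\varepsilon^{-1}}\delta^x_\varepsilon u=u$ for $\varepsilon\in\Gamma_1$, $u\in U(x)$. Moreover for any compact $K\subset X$ there are $R=R(K)>0$ and $\varepsilon_0=\varepsilon_0(K)\in(0,1)$ such that for all $x\in K$, $u,v\in\bar B_d(x,R)$ and $\nu(\varepsilon)\in(0,\varepsilon_0)$: $\delta^x_\varepsilon v\in W_{\varepsilon^{-1}}(\delta^x_\varepsilon u)$. A1. $\delta^x_1=\mathrm{id}$; $\frac1{\nu(\varepsilon)}d(x,\delta^x_\varepsilon x)\to0$ as $\varepsilon\to0$, uniformly for $x$ in compact sets (strong form: $\delta^x_\varepsilon x=x$); the map $(\varepsilon,x,y)\mapsto\delta^x_\varepsilon y$ is continuous on $\mathrm{dom}\,\delta=\{(\varepsilon,x,y)\in\Gamma\times X\times X: y\in U(x)\text{ if }\nu(\varepsilon)\le1,\ y\in W_\varepsilon(x)\text{ otherwise}\}$ and extends continuously to the closure of $\mathrm{dom}\,\delta$ in $(\Gamma\cup\{0\})\times X\times X$, with $\lim_{\varepsilon\to0}\delta^x_\varepsilon y=x$. A2. For any compact $K$, $x\in K$, $\nu(\varepsilon),\nu(\mu)\in(0,1)$,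 $u,v\in\bar B_d(x,A)$: $\frac{1}{\nu(\varepsilon\mu)}|d(\delta^x_\varepsilon\delta^x_\mu u,\delta^x_\varepsilon\delta^x_\mu v)-d(\delta^x_{\varepsilon\mu}u,\delta^x_{\varepsilon\mu}v)|\le\mathcal O(\varepsilon\mu)$ (strong form: $\delta^x_\varepsilon\delta^x_\mu u=\delta^x_{\varepsilon\mu}u$). A3. For any $x$ there is a function $(u,v)\mapsto d^x(u,v)$ on $\bar B_d(x,A)^2$ with $\lim_{\varepsilon\to0}\sup\{|\frac1{\nu(\varepsilon)}d(\delta^x_\varepsilon u,\delta^x_\varepsilon v)-d^x(u,v)|:u,v\in\bar B_d(x,A)\}=0$, uniformly for $x$ in compact sets; and $d^x$ is non-degenerate ($d^x(u,v)=0\Rightarrow u=v$). A4. With $\Delta^x_\varepsilon(u,v)=\delta_{\varepsilon^{-1}}^{\delta^x_\varepsilon u}\delta^x_\varepsilon v$, the limit $\lim_{\varepsilon\to0}\Delta^x_\varepsilon(u,v)=\Delta^x(u,v)$ exists uniformly with respect to $x,u,v$ in compact sets. All compositions such as $\Sigma^x_\varepsilon(u,v)$ are local: $u,v$ are taken sufficiently close to $x$ and $\nu(\varepsilon)$ sufficiently small.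
   Formalization: The constant C may depend on the compact set in which x varies (as R(K) in A0 does), with u and v both within C of x; a single C for all x of a non-compact X fails under the local reading of the axioms. *)

(* Defs.v *)
From HB Require Import structures.
From mathcomp Require Import all_boot all_order all_algebra.
From mathcomp Require Import all_classical all_reals all_analysis.

Set Implicit Arguments.
Unset Strict Implicit.
Unset Printing Implicit Defensive.

Import Order.TTheory GRing.Theory Num.Theory.
Import numFieldNormedType.Exports.

Local Open Scope classical_set_scope.
Local Open Scope ring_scope.

HB.mixin Record isTopologicalComGroup G & Topological G & Group G := {
  comg_mulC : @commutative G G *%g;
  mulg_continuous : continuous (fun x : G * G => (x.1 * x.2)%g);
  invg_continuous : continuous (fun x : G => x^-1%g)
}.

#[short(type="topologicalComGroupType")]
HB.structure Definition TopologicalComGroup :=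
  {G of Topological G & Group G & isTopologicalComGroup G}.

#[short(type="completeMetricType")]
HB.structure Definition CompleteMetric (R : numDomainType) :=
  {T of CompletePseudoMetric R T & Metric R T}.

(* The morphism from the group of scales to the multiplicative group of
   positive reals. *)
Record scale (G : topologicalComGroupType) (R : realType) := Scale {
  nu :> G -> R;
  nu_gt0 : forall e, 0 < nu e;
  nuM : forall e m, nu (e * m)%g = nu e * nu m;
  nu_continuous : continuous nu;
  nu_inf : inf (range nu) = 0
}.

Definition at0 (G : topologicalComGroupType) (R : realType) (nu : scale G R) :
    set_system G :=
  filter_from [set a : R | 0 < a] (fun a => [set e | nu e < a]).

(* [G] with an element [0] adjoined, encoded as [None]. *)
Definition adjoin0 (G : topologicalComGroupType) (R : realType)
  (nu : scale G R) : Type := option G.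

Section adjoin0_topology.
Context {G : topologicalComGroupType} {R : realType} {nu : scale G R}.

Local Notation G0 := (adjoin0 nu).

HB.instance Definition _ := Choice.on G0.

Definition adjoin0_nbhs (x : G0) : set_system G0 :=
  if x is Some e then Some @ nbhs e else
    filter_from [set a : R | 0 < a]
      (fun a => Some @` [set e | nu e < a] `|` [set None]).

Let adjoin0_filter (x : G0) : ProperFilter (adjoin0_nbhs x).
Proof.
case: x => [e|]; first exact: fmap_proper_filter.
apply: filter_from_proper; last by move=> a _; exists None; right.
apply: filter_from_filter; first by exists 1 => /=.
move=> a b /= a0 b0; exists (Num.min a b); first by rewrite /= lt_min a0.
move=> _ [[e eab <-]|->]; last by split; right.
by move: eab; rewrite /= lt_min => /andP[ea eb]; split; left; exists e.
Qed.

Let adjoin0_singleton (x : G0) U : adjoin0_nbhs x U -> U x.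
Proof. by case: x => [e /nbhs_singleton//|[a _]]; apply; right. Qed.

Let adjoin0_nbhs_nbhs (x : G0) (U : set G0) :
  adjoin0_nbhs x U -> adjoin0_nbhs x (adjoin0_nbhs^~ U).
Proof.
case: x => [e /=|].
  rewrite nbhs_simpl nbhsE => -[V [oV Ve] VU /=].
  by exists V => //= f /=; rewrite nbhs_simpl nbhsE => Vf; exists V.
case=> a a0 aU; exists a => // _ [[e ea <-]|->] /=; last by exists a.
have nua : nbhs (nu e) [set r | r < a].
  by apply: open_nbhs_nbhs; split => //; exact: open_lt.
have := nu_continuous nua; rewrite /= !nbhs_simpl.
by apply: (@filterS _ (nbhs e)) => f fa; apply: aU; left; exists f.
Qed.

HB.instance Definition _ := hasNbhs.Build G0 adjoin0_nbhs.

HB.instance Definition _ := @Nbhs_isNbhsTopological.Build G0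
  adjoin0_filter adjoin0_singleton adjoin0_nbhs_nbhs.

End adjoin0_topology.

(* [closed_ball x r] in the library is the closure of the open ball, which in a
   metric space may be smaller. *)
Definition cball (R : realType) (X : metricType R) (x : X) (r : R) : set X :=
  [set y | mdist x y <= r].

Definition homeo_on (S T : topologicalType) (A : set S) (B : set T)
    (f : S -> T) : Prop :=
  [/\ set_bij A B f, {within A, continuous f} &
      exists g : T -> S, {in A, cancel f g} /\ {within B, continuous g}].

Definition uncurry3 (S T : Type) (f : S -> S -> S -> T) (p : S * S * S) : T :=
  f p.1.1 p.1.2 p.2.

Section dilatation.
Context (G : topologicalComGroupType) (R : realType) (nu : scale G R)
        (X : completeMetricType R).
Implicit Types (e m : G) (x u v : X) (K : set X).

Definition local_triples K (r : R) : set (X * X * X) :=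
  [set p | [/\ K p.1.1, cball p.1.1 r p.1.2 & cball p.1.1 r p.2]].

(* [dil e x] is meaningful only on [dil_dom e x]; [dilU], [dilV] are used for
   [nu e <= 1] and [dilW] for [nu e > 1].  [tdist x] is meaningful only on
   [cball x dilA]. *)
Record dilatation_data := DilatationData {
  dil : G -> X -> X -> X;
  dilA : R;
  dilB : R;
  dilU : X -> set X;
  dilV : G -> X -> set X;
  dilW : G -> X -> set X;
  tdist : X -> X -> X -> R
}.

Section axioms.
Variable D : dilatation_data.
Local Notation A := (dilA D).
Local Notation B := (dilB D).
Local Notation U := (dilU D).
Local Notation V := (dilV D).
Local Notation W := (dilW D).

Definition dil_dom e x : set X := if nu e <= 1 then U x else W e x.

Definition graph_dom : set (G * X * X) := [set p | dil_dom p.1.1 p.1.2 p.2].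

Definition graph_dom0 : set (adjoin0 nu * X * X) :=
  [set (Some p.1.1, p.1.2, p.2) | p in graph_dom].

Definition Delta_ e x u v : X := dil D e^-1%g (dil D e x u) (dil D e x v).

Definition Sigma_ e x u v : X := dil D e^-1%g x (dil D e (dil D e x u) v).

Definition Sigma_defined e x u v : Prop :=
  [/\ dil_dom e x u, dil_dom e (dil D e x u) v &
      dil_dom e^-1%g x (dil D e (dil D e x u) v)].

Definition tdist_nondegenerate x : Prop :=
  forall u v, cball x A u -> cball x A v -> tdist D x u v = 0 -> u = v.

Definition axiom_A0 : Prop :=
  [/\ 1 < A,
      forall x, cball x A `<=` U x,
      forall e x, nu e <= 1 -> homeo_on (U x) (V e x) (dil D e x),
      forall e x, nu e < 1 ->
        [/\ ball x (nu e) `<=` dil D e x @` ball x A,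
            dil D e x @` ball x A `<=` V e x & V e x `<=` U x] &
  [/\ forall e x, 1 < nu e ->
        [/\ homeo_on (W e x) (dil D e x @` W e x) (dil D e x),
            dil D e x @` W e x `<=` ball x B,
            open (W e x) & V e^-1%g x `<=` W e x],
      forall e x u, nu e <= 1 -> U x u ->
        dil_dom e^-1%g x (dil D e x u) /\ dil D e^-1%g x (dil D e x u) = u &
      forall K, compact K -> exists r e0 : R, [/\ 0 < r, 0 < e0 < 1 &
        forall x u v e, K x -> cball x r u -> cball x r v -> nu e < e0 ->
          W e^-1%g (dil D e x u) (dil D e x v)]]].

Definition axiom_A1 : Prop :=
  [/\ forall x u, U x u -> dil D 1%g x u = u,
      forall K, compact K ->
        {uniform K, (fun e x => (nu e)^-1 * mdist x (dil D e x x)) @ at0 nu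
                    --> (fun=> 0 : R)},
      {within graph_dom, continuous (fun p => dil D p.1.1 p.1.2 p.2)},
      exists f : adjoin0 nu * X * X -> X,
        {within closure graph_dom0, continuous f} /\
        (forall e x u, dil_dom e x u -> f (Some e, x, u) = dil D e x u) &
      forall x u, U x u -> dil D e x u @[e --> at0 nu] --> x].

Definition axiom_A2 : Prop :=
  forall K, compact K -> exists O : G -> R,
    [/\ forall e, 0 < O e, O @ at0 nu --> (0 : R) &
        forall x e m u v, K x -> nu e < 1 -> nu m < 1 ->
          cball x A u -> cball x A v ->
          (nu (e * m)%g)^-1 *
            `|mdist (dil D e x (dil D m x u)) (dil D e x (dil D m x v))
              - mdist (dil D (e * m)%g x u) (dil D (e * m)%g x v)|
          <= O (e * m)%g].

Definition axiom_A3 : Prop :=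
  (forall K, compact K ->
    {uniform local_triples K A,
      (fun e => uncurry3 (fun x u v =>
         (nu e)^-1 * mdist (dil D e x u) (dil D e x v))) @ at0 nu
      --> uncurry3 (tdist D)}) /\
  (forall x, tdist_nondegenerate x).

(* The radius may be taken below the one given by A0, so that [Delta_ e x u v]
   is defined for small [e]. *)
Definition axiom_A4 : Prop :=
  exists Delta : X -> X -> X -> X, forall K, compact K ->
    exists2 r : R, 0 < r &
      {uniform local_triples K r,
        (fun e => uncurry3 (Delta_ e)) @ at0 nu --> uncurry3 Delta}.

End axioms.

Record dilatation_structure := DilatationStructure {
  dil_data :> dilatation_data;
  dil_A0 : axiom_A0 dil_data;
  dil_A1 : axiom_A1 dil_data;
  dil_A2 : axiom_A2 dil_data;
  dil_A3 : axiom_A3 dil_data;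
  dil_A4 : axiom_A4 dil_data
}.

Definition tdist_isometry_on (D : dilatation_data) x (S : set X)
    (f : X -> X) : Prop :=
  (forall v, S v -> cball x (dilA D) (f v)) /\
  (forall v w, S v -> S w -> tdist D x (f v) (f w) = tdist D x v w).

End dilatation.

(* Main.v *)
(* With z = dil e x u, Sigma_ e x u is the inverse of the difference map
   Delta_ e x u, because dil e x (Sigma_ e x u v) = dil e z v.  Dividing
   distances by nu e and letting e tend to 0 in this identity, A3 shows that
   any limit of Sigma_ e x u is a d^x-isometry; the same computation shows that
   the limit Delta x u given by A4 is one.  If y and y' are the values of
   Sigma_ e x u v at two small scales, Delta x u maps both of them close to v,
   hence d^x y y' is small, hence y and y' are close: Sigma_ is uniformly
   Cauchy and X is complete.  Uniformity over compact sets is obtained by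
   replacing a family of counterexamples by an ultrafilter, along which all
   the points involved converge. *)
Require Import Defs.
From mathcomp Require Import all_boot all_order all_algebra.
From mathcomp Require Import all_classical all_reals all_analysis.
From mathcomp Require Import lra.
Import Order.TTheory GRing.Theory Num.Theory.
Import numFieldNormedType.Exports.
Local Open Scope classical_set_scope.
Local Open Scope ring_scope.

Set Implicit Arguments.
Unset Strict Implicit.

Lemma ultra_cvg (T : Type) (X : topologicalType) (F : set_system T)
    (f : T -> X) (K : set X) :
  UltraFilter F -> compact K -> (\forall t \near F, K (f t)) ->
  exists2 p, K p & f @ F --> p.
Proof.
move=> FU cK FK; have FF : ProperFilter F by exact: ultra_proper.
have [p [Kp clp]] := cK _ (fmap_proper_filter f FF) FK.
exists p => // V Vp; case: (in_ultra_setVsetC (f @^-1` V) FU) => // FV.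
by have [q []] := clp (~` V) V FV Vp.
Qed.

Lemma cvg_eq_near (T : Type) (Y : topologicalType) (F : set_system T)
    {FF : Filter F} (f g : T -> Y) (y : Y) :
  (\forall t \near F, f t = g t) -> f @ F --> y -> g @ F --> y.
Proof. by move=> fg; apply: cvg_trans; apply: near_eq_cvg. Qed.

Section uniform_cvg.
Context (R : realType) (T : Type) (S : choiceType) (Y : pseudoMetricType R)
  (A : set S) (F : set_system T) (f : T -> S -> Y) (g : S -> Y).

Lemma uniform_cvg_ball (eps : R) : {uniform A, f @ F --> g} -> 0 < eps ->
  \forall t \near F, forall s, A s -> ball (g s) eps (f t s).
Proof.
move=> fg eps0.
suff: nbhs (g : {uniform` A -> Y})
    [set h | forall s, A s -> ball (g s) eps (h s)].
  by exact: fg.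
apply/uniform_nbhs; exists [set p | ball p.1 eps p.2]; split=> //.
exact: entourage_ball (PosNum eps0).
Qed.

Lemma ball_uniform_cvg : Filter F ->
  (forall eps : R, 0 < eps ->
    \forall t \near F, forall s, A s -> ball (g s) eps (f t s)) ->
  {uniform A, f @ F --> g}.
Proof.
move=> FF fg P /uniform_nbhs[E [+ EP]].
rewrite -entourage_from_ballE => -[eps /= e0 bE].
have := fg _ e0; apply: filterS => t ft; apply: EP => s As; apply: bE.
exact: ft.
Qed.

End uniform_cvg.

Lemma ball_mdist (R : realType) (X : metricType R) (x y : X) r :
  ball x r y = (mdist x y < r) :> Prop.
Proof. by rewrite -metricType_numDomainType.ball_mdistE. Qed.

Section metric.
Context (R : realType) (X : metricType R).
Implicit Types (x y u v : X).

Lemma nbhs_cball x (r : R) : 0 < r -> nbhs x (cball x r).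
Proof.
move=> r0; apply: filterS (nbhsx_ballx x r r0) => y.
by rewrite ball_mdist => /ltW.
Qed.

Section filter.
Context (T : Type) (F : set_system T) {FF : Filter F}.
Implicit Types f g : T -> X.

Lemma cvg_mdistP f x : f @ F --> x <->
  forall eps : R, 0 < eps -> \forall t \near F, mdist x (f t) < eps.
Proof. exact: metricType_numDomainType.cvgrPdist_lt. Qed.

Lemma cvg_mdist f g x y : f @ F --> x -> g @ F --> y ->
  mdist (f t) (g t) @[t --> F] --> mdist x y.
Proof.
move=> /cvg_mdistP fx /cvg_mdistP gy; apply/cvgrPdist_lt => eps eps0.
have e2 : 0 < eps / 2 by rewrite divr_gt0.
near=> t.
have fxt : mdist x (f t) < eps / 2 by near: t; exact: fx.
have gyt : mdist y (g t) < eps / 2 by near: t; exact: gy.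
have := metric_triangle x (f t) y; have := metric_triangle (f t) (g t) y.
have := metric_triangle (f t) x (g t); have := metric_triangle x y (g t).
rewrite (metric_sym (f t) x) (metric_sym (g t) y) => h1 h2 h3 h4.
by rewrite ltr_norml; apply/andP; split; lra.
Unshelve. all: by end_near. Qed.

Lemma cvg_mdist0 f g x : f @ F --> x ->
  mdist (f t) (g t) @[t --> F] --> (0 : R) -> g @ F --> x.
Proof.
move=> /cvg_mdistP fx /cvgr0Pnorm_lt fg; apply/cvg_mdistP => eps eps0.
have e2 : 0 < eps / 2 by rewrite divr_gt0.
near=> t.
have fxt : mdist x (f t) < eps / 2 by near: t; exact: fx.
have : `|mdist (f t) (g t)| < eps / 2 by near: t; exact: fg.
rewrite ger0_norm ?mdist_ge0// => fgt.
by have := metric_triangle x (f t) (g t); lra.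
Unshelve. all: by end_near. Qed.

Lemma cvg_near_cball f g x y (r s : R) : f @ F --> x -> g @ F --> y ->
  cball x r y -> r < s -> \forall t \near F, cball (f t) s (g t).
Proof.
move=> fx gy xy rs; have := cvg_mdist fx gy => /cvgrPdist_lt/(_ (s - r)).
rewrite subr_gt0 => /(_ rs); apply: filterS => t.
by rewrite ltr_norml /cball /= in xy * => /andP[]; lra.
Qed.

End filter.

Lemma cvg_cball (T : Type) (F : set_system T) {FF : ProperFilter F}
    (f g : T -> X) x y (r : R) : f @ F --> x -> g @ F --> y ->
  (\forall t \near F, cball (f t) r (g t)) -> cball x r y.
Proof.
move=> fx gy fg; rewrite /cball /=.
exact: (cvgr_to_le (cvg_mdist fx gy) fg).
Qed.

Lemma closed_cball x (r : R) : closed (cball x r).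
Proof.
move=> y; rewrite closureEcvg => -[F FF [Fy EF]].
apply: (@cvg_cball _ F _ (fun=> x) id) => //; first exact: cvg_cst.
exact: EF.
Qed.

Lemma compact_cball_sub x y (r s : R) : compact (cball y s) ->
  mdist y x + r <= s -> compact (cball x r).
Proof.
move=> cy xys; apply: (subclosed_compact _ cy); first exact: closed_cball.
by move=> z; rewrite /cball /=; have := metric_triangle y x z; lra.
Qed.

Lemma ultra_cvg_cball (T : Type) (F : set_system T) (FU : UltraFilter F)
    (f g : T -> X) x (r s : R) : compact (cball x s) -> r < s ->
    f @ F --> x -> (\forall t \near F, cball (f t) r (g t)) ->
  exists2 y, cball x r y & g @ F --> y.
Proof.
have FF : ProperFilter F by exact: ultra_proper.
move=> cx rs fx fg.
have [|y _ gy] := ultra_cvg (f := g) FU cx.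
  have fxs : \forall t \near F, mdist x (f t) < s - r.
    by move/cvg_mdistP: fx; apply; rewrite subr_gt0.
  near=> t; rewrite /cball /=; have := metric_triangle x (f t) (g t).
  have : mdist x (f t) < s - r by near: t.
  have : cball (f t) r (g t) by near: t.
  by rewrite /cball /=; lra.
by exists y => //; exact: (cvg_cball fx gy).
Unshelve. all: by end_near. Qed.

Lemma locally_compact_cball x : locally_compact [set: X] ->
  exists2 r : R, 0 < r & compact (cball x r).
Proof.
move=> /(_ x I) [U]; rewrite withinET => /nbhs_ballP[r /= r0 xrU] [cU clU].
exists (r / 2); first by rewrite divr_gt0.
apply: (subclosed_compact _ cU); first exact: closed_cball.
move=> y xy; apply: xrU; rewrite ball_mdist; move: xy.
by rewrite /cball /=; lra.
Qed.

Lemma compact_cball_uniform (K : set X) : locally_compact [set: X] ->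
  compact K -> exists2 r : R, 0 < r & forall x, K x -> compact (cball x r).
Proof.
move=> hX /compact_near_coveringP /(_ R (0^'+) (fun r x => compact (cball x r))).
case=> [x _|].
  have [r r0 cr] := locally_compact_cball x hX.
  have r2 : 0 < r / 2 by rewrite divr_gt0.
  near=> y s; apply: (compact_cball_sub cr) => //.
  have : ball x (r / 2) y by near: y; exact: nbhsx_ballx.
  have : s < r / 2 by near: s; exact: nbhs_right_lt.
  by rewrite ball_mdist /=; lra.
move=> r /= r0 rK; exists (r / 2); first by rewrite divr_gt0.
apply: rK; rewrite /= ?divr_gt0// sub0r normrN gtr0_norm ?divr_gt0//; lra.
Unshelve. all: by end_near. Qed.

End metric.

Lemma near_ultra (S T : Type) (H : set_system S) (P Q : S -> T -> Prop) :
    Filter H ->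
    (forall F : set_system (S * T), UltraFilter F -> fst @ F --> H ->
      (\forall p \near F, P p.1 p.2) -> \forall p \near F, Q p.1 p.2) ->
  \forall s \near H, forall t, P s t -> Q s t.
Proof.
move=> FH HPQ; apply: contrapT => nPQ.
pose bad B := [set p : S * T | [/\ B p.1, P p.1 p.2 & ~ Q p.1 p.2]].
have badF : ProperFilter (filter_from H bad).
  apply: filter_from_proper.
    apply: filter_from_filter; first by exists setT; exact: filterT.
    move=> B C HB HC; exists (B `&` C); first exact: filterI.
    by move=> p [[? ?] ? ?]; split; split.
  move=> B HB; apply: contrapT => nbad; apply: nPQ.
  apply: filterS HB => s Bs t Pst; apply: contrapT => nQst.
  by apply: nbad; exists (s, t).
have [F [FU badsF]] := ultraFilterLemma badF.
have FF : ProperFilter F by exact: ultra_proper.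
have bF B : H B -> F (bad B) by move=> HB; apply: badsF; exists B.
have FQ : F [set p | Q p.1 p.2].
  apply: HPQ => //; last by apply: filterS (bF _ filterT) => p [].
  move=> B HB; apply: (@filterS _ F _ (bad B)) (bF B HB); by move=> p -[].
by have [p [Qp [_ _ /(_ Qp)]]] := filter_ex (filterI FQ (bF _ filterT)).
Qed.

Section scale.
Context (G : topologicalComGroupType) (R : realType) (nu : scale G R).

Lemma nu_small (a : R) : 0 < a -> exists e, nu e < a.
Proof.
move=> a0; have hi : has_inf (range nu).
  by split; [exists (nu 1%g), 1%g|exists 0 => _ [e _ <-]; apply/ltW/nu_gt0].
have [_ [e _ <-]] := inf_adherent a0 hi.
by rewrite (nu_inf nu) add0r; exists e.
Qed.

Global Instance at0_proper : ProperFilter (at0 nu).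
Proof.
apply: filter_from_proper; last by move=> a /nu_small[e]; exists e.
apply: filter_from_filter; first by exists 1 => /=.
move=> a b /= a0 b0; exists (Num.min a b); first by rewrite /= lt_min a0.
by move=> e /=; rewrite lt_min => /andP.
Qed.

Lemma at0_lt (a : R) : 0 < a -> \forall e \near at0 nu, nu e < a.
Proof. by move=> a0; exists a. Qed.

Lemma cvg_at0_mulr m : (e * m)%g @[e --> at0 nu] --> at0 nu.
Proof.
move=> S [a /= a0 aS]; exists (a / nu m); first by rewrite /= divr_gt0 ?nu_gt0.
by move=> e /=; rewrite ltr_pdivlMr ?nu_gt0// => ea; apply: aS; rewrite /= nuM.
Qed.

Lemma cvg_nu_at0 (T : Type) (F : set_system T) {FF : Filter F} (e : T -> G) :
  e @ F --> at0 nu -> nu (e t) @[t --> F] --> (0 : R).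
Proof.
move=> e0; apply/cvgr0Pnorm_lt => a a0.
have : \forall t \near F, nu (e t) < a by exact: e0 _ (at0_lt a0).
by apply: filterS => t; rewrite gtr0_norm ?nu_gt0.
Qed.

End scale.

Section dilatation.
Context (G : topologicalComGroupType) (R : realType) (nu : scale G R)
  (X : completeMetricType R) (D : dilatation_structure nu X)
  (hX : locally_compact [set: X]).
Local Notation A := (dilA D).
Local Notation dom := (dil_dom nu D).
Implicit Types (e m : G) (x u v : X).

Lemma dilA_gt0 : 0 < A.
Proof. by have [[A1 _ _ _] _] := dil_A0 D; rewrite (lt_trans ltr01). Qed.

Lemma cball_sub_dom e x u : nu e <= 1 -> cball x A u -> dom e x u.
Proof. by move=> e1; have [[_ + _ _] _] := dil_A0 D; rewrite /dil_dom e1; apply. Qed.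

Lemma dilK e x u : nu e <= 1 -> cball x A u ->
  dom e^-1%g x (dil D e x u) /\ dil D e^-1%g x (dil D e x u) = u.
Proof.
by move=> e1 xu; have [[_ h _ _] [_ + _]] := dil_A0 D; apply=> //; exact: h.
Qed.

Lemma ball_sub_dil e x y : nu e < 1 -> mdist x y < nu e ->
  exists2 w, cball x A w & dil D e x w = y.
Proof.
move=> e1 xy; have [[_ _ _ /(_ e x e1)[h _ _]] _] := dil_A0 D.
have [|w] := h y; first by rewrite ball_mdist.
by rewrite ball_mdist => xw wy; exists w => //; exact: ltW.
Qed.

Lemma cvg_dil (T : Type) (F : set_system T) (FF : Filter F) (x u : T -> X)
    e x0 u0 :
  x @ F --> x0 -> u @ F --> u0 -> dom e x0 u0 ->
  (\forall t \near F, dom e (x t) (u t)) ->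
  dil D e (x t) (u t) @[t --> F] --> dil D e x0 u0.
Proof.
move=> xx0 uu0 d0 dF; have [_ _ + _ _] := dil_A1 D.
move=> /subspace_continuousP/(_ (e, x0, u0) d0) h S /h hS.
have cF : (e, x t, u t) @[t --> F] --> (e, x0, u0).
  exact: (cvg_pair (cvg_pair (cvg_cst e) xx0) uu0).
have hF : \forall t \near F, dom e (x t) (u t) -> S (dil D e (x t) (u t)).
  exact: cF _ hS.
by apply: (filterS2 _ _ dF hF) => t dt; apply.
Qed.

Lemma tdist_uniform x0 : exists2 K, nbhs x0 K & forall eps : R, 0 < eps ->
  \forall e \near at0 nu, forall x u v, K x -> cball x A u -> cball x A v ->
    `|(nu e)^-1 * mdist (dil D e x u) (dil D e x v) - tdist D x u v| < eps.
Proof.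
have [r r0 cr] := locally_compact_cball x0 hX.
exists (cball x0 r); first exact: nbhs_cball.
move=> eps eps0; have [/(_ _ cr) h _] := dil_A3 D.
have := uniform_cvg_ball h eps0.
apply: filterS => e he x u v x0x xu xv.
by have := he (x, u, v) (And3 x0x xu xv); rewrite /ball /= distrC.
Qed.

Section limits.
Context (T : Type) (F : set_system T) {FF : ProperFilter F}.
Implicit Types (s : T -> G) (f g h : T -> X).

Lemma tdist_near s f g h x0 : s @ F --> at0 nu -> f @ F --> x0 ->
  (\forall t \near F, cball (f t) A (g t)) ->
  (\forall t \near F, cball (f t) A (h t)) ->
  (nu (s t))^-1 * mdist (dil D (s t) (f t) (g t)) (dil D (s t) (f t) (h t))
    - tdist D (f t) (g t) (h t) @[t --> F] --> (0 : R).
Proof.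
move=> s0 fx0 fg fh; have [K x0K KA] := tdist_uniform x0.
apply/cvgr0Pnorm_lt => eps eps0.
have sF := s0 _ (KA _ eps0).
near=> t.
suff: forall x u v, K x -> cball x A u -> cball x A v ->
  `|(nu (s t))^-1 * mdist (dil D (s t) x u) (dil D (s t) x v) - tdist D x u v| < eps.
  by apply; near: t => //; exact: fx0.
by near: t; exact: sF.
Unshelve. all: by end_near. Qed.

Lemma cvg_tdist f g h x0 u0 v0 : f @ F --> x0 -> g @ F --> u0 -> h @ F --> v0 ->
  (\forall t \near F, cball (f t) A (g t)) ->
  (\forall t \near F, cball (f t) A (h t)) ->
  tdist D (f t) (g t) (h t) @[t --> F] --> tdist D x0 u0 v0.
Proof.
move=> fx0 gu0 hv0 fg fh; have [K x0K KA] := tdist_uniform x0.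
have xu0 : cball x0 A u0 by exact: cvg_cball fx0 gu0 fg.
have xv0 : cball x0 A v0 by exact: cvg_cball fx0 hv0 fh.
apply/cvgrPdist_lt => eps eps0.
have e3 : 0 < eps / 3 by rewrite divr_gt0.
have [e [e1 Ke]] := filter_ex (filterI (at0_lt nu ltr01) (KA _ e3)).
have de g' u' : g' @ F --> u' -> cball x0 A u' ->
    (\forall t \near F, cball (f t) A (g' t)) ->
    dil D e (f t) (g' t) @[t --> F] --> dil D e x0 u'.
  move=> gu' xu' fg'; apply: cvg_dil => //; first exact: cball_sub_dom (ltW e1) xu'.
  by apply: filterS fg' => t; exact: cball_sub_dom (ltW e1).
have /cvgrPdist_lt/(_ _ e3) lim : (nu e)^-1 *
    mdist (dil D e (f t) (g t)) (dil D e (f t) (h t)) @[t --> F] -->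
    (nu e)^-1 * mdist (dil D e x0 u0) (dil D e x0 v0).
  by apply: cvgMr; apply: cvg_mdist; [exact: de xu0 fg|exact: de xv0 fh].
have h0 := Ke _ _ _ (nbhs_singleton x0K) xu0 xv0.
near=> t.
have : `|(nu e)^-1 * mdist (dil D e (f t) (g t)) (dil D e (f t) (h t))
    - tdist D (f t) (g t) (h t)| < eps / 3.
  by apply: Ke; near: t => //; exact: fx0.
have : `|(nu e)^-1 * mdist (dil D e x0 u0) (dil D e x0 v0) - (nu e)^-1 *
    mdist (dil D e (f t) (g t)) (dil D e (f t) (h t))| < eps / 3 by near: t.
move: h0; rewrite !ltr_norml => /andP[? ?] /andP[? ?] /andP[? ?].
by apply/andP; split; lra.
Unshelve. all: by end_near. Qed.

Lemma cvg_tdist_dil s f g h x0 u0 v0 : s @ F --> at0 nu ->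
  f @ F --> x0 -> g @ F --> u0 -> h @ F --> v0 ->
  (\forall t \near F, cball (f t) A (g t)) ->
  (\forall t \near F, cball (f t) A (h t)) ->
  (nu (s t))^-1 * mdist (dil D (s t) (f t) (g t)) (dil D (s t) (f t) (h t))
    @[t --> F] --> tdist D x0 u0 v0.
Proof.
move=> s0 fx0 gu0 hv0 fg fh.
pose proof (cvgD (tdist_near s0 fx0 fg fh) (cvg_tdist fx0 gu0 hv0 fg fh)) as h1.
rewrite add0r in h1; apply: cvg_eq_near h1.
by apply: nearW => t /=; rewrite subrK.
Qed.

Lemma cvg_dil_base s f x0 : s @ F --> at0 nu -> f @ F --> x0 ->
  (nu (s t))^-1 * mdist (f t) (dil D (s t) (f t) (f t)) @[t --> F] --> (0 : R).
Proof.
move=> s0 fx0; have [r r0 cr] := locally_compact_cball x0 hX.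
have [_ /(_ _ cr) h _ _ _] := dil_A1 D.
apply/cvgr0Pnorm_lt => eps eps0.
have sF := s0 _ (uniform_cvg_ball h eps0).
near=> t.
suff: forall x, cball x0 r x ->
    ball (0 : R) eps ((nu (s t))^-1 * mdist x (dil D (s t) x x)).
  have fr : cball x0 r (f t) by near: t; exact: fx0 _ (nbhs_cball x0 r0).
  by move=> /(_ _ fr); rewrite /ball /= sub0r normrN.
by near: t; exact: sF.
Unshelve. all: by end_near. Qed.

Lemma cvg_dil_at0 s f g x0 u0 : s @ F --> at0 nu -> f @ F --> x0 ->
  g @ F --> u0 -> (\forall t \near F, cball (f t) A (g t)) ->
  dil D (s t) (f t) (g t) @[t --> F] --> x0.
Proof.
move=> s0 fx0 gu0 fg; apply: (cvg_mdist0 fx0).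
have ff : \forall t \near F, cball (f t) A (f t).
  by apply: nearW => t; rewrite /cball /= mdistxx ltW ?dilA_gt0.
pose proof (cvgD (cvg_dil_base s0 fx0) (cvg_tdist_dil s0 fx0 fx0 gu0 ff fg)) as lim0.
pose proof (cvgM (cvg_nu_at0 s0) lim0) as lim; rewrite mul0r in lim.
apply: (squeeze_cvgr _ (cvg_cst 0) lim).
apply: nearW => t /=; rewrite mdist_ge0 /= -mulrDr mulVKf ?gt_eqF ?nu_gt0//.
exact: metric_triangle.
Qed.

End limits.

Lemma cballxx x (r : R) : 0 <= r -> cball x r x.
Proof. by rewrite /cball /= mdistxx. Qed.

Lemma tdistxx x u : cball x A u -> tdist D x u u = 0.
Proof.
move=> xu; have xuF : \forall e \near at0 nu, cball x A u by exact: nearW.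
pose proof (cvg_tdist_dil cvg_id (cvg_cst x) (cvg_cst u) (cvg_cst u) xuF xuF) as lim.
apply: (cvg_unique _ lim) => //; apply: cvg_eq_near (cvg_cst 0).
by apply: nearW => e; rewrite mdistxx mulr0.
Qed.

Lemma tdist_dil x m u v : nu m < 1 -> cball x A u -> cball x A v ->
  cball x A (dil D m x u) -> cball x A (dil D m x v) ->
  tdist D x (dil D m x u) (dil D m x v) = nu m * tdist D x u v.
Proof.
move=> m1 xu xv xmu xmv.
have xF w : cball x A w -> \forall e \near at0 nu, cball x A w.
  by move=> ?; exact: nearW.
pose proof (cvg_tdist_dil cvg_id (cvg_cst x) (cvg_cst _) (cvg_cst _)
  (xF _ xmu) (xF _ xmv)) as lim1.
pose proof (cvg_tdist_dil (@cvg_at0_mulr _ _ nu m) (cvg_cst x)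
  (cvg_cst _) (cvg_cst _) (xF _ xu) (xF _ xv)) as lim2.
have m0 := nu_gt0 nu m.
have [rem [_ rem0 hrem]] := dil_A2 D (@compact_set1 _ x).
pose proof (cvg_norm (cvgB (cvgMr (a := (nu m)^-1) lim1) lim2)) as lim3.
have lim4 : rem (e * m)%g @[e --> at0 nu] --> (0 : R).
  exact: cvg_comp (@cvg_at0_mulr _ _ nu m) rem0.
have : `|(nu m)^-1 * tdist D x (dil D m x u) (dil D m x v) - tdist D x u v| <= 0.
  apply: (ler_cvg_to lim3 lim4); near=> e.
  have e1 : nu e < 1 by near: e; exact: at0_lt.
  have := hrem x e m u v erefl e1 m1 xu xv.
  rewrite -[X in X * `|_| <= _]gtr0_norm ?invr_gt0 ?nu_gt0// -normrM mulrBr.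
  rewrite [X in `|X - _|](_ : _ = (nu m)^-1 * ((nu e)^-1 *
    mdist (dil D e x (dil D m x u)) (dil D e x (dil D m x v)))) //.
  by rewrite nuM invfM mulrCA mulrA.
rewrite normr_le0 subr_eq0 => /eqP <-; rewrite mulVKf ?gt_eqF//.
Unshelve. all: by end_near. Qed.

(* [cball x A] need not be compact.  A dilatation of small scale [m] maps it
   into a compact ball, where tdist x0 separates the limit points because it
   is multiplied by [nu m]; one then comes back with the dilatation of scale
   [m^-1]. *)
Lemma cvg_of_tdist0 (T : Type) (F : set_system T) (FU : UltraFilter F)
    (f g h : T -> X) x0 v0 : f @ F --> x0 -> h @ F --> v0 ->
  (\forall t \near F, cball (f t) A (g t)) ->
  (\forall t \near F, cball (f t) A (h t)) ->
  tdist D (f t) (g t) (h t) @[t --> F] --> (0 : R) -> g @ F --> v0.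
Proof.
have FF : ProperFilter F by exact: ultra_proper.
move=> fx0 hv0 fg fh gh0.
have xv0 : cball x0 A v0 by exact: cvg_cball fx0 hv0 fh.
have A0 := dilA_gt0.
have [r0 r00 cr0] := locally_compact_cball x0 hX.
pose r := Num.min r0 (A / 2).
have rr0 : 0 < r by rewrite lt_min r00 divr_gt0.
have rA : r <= A / 2 by rewrite ge_min lexx orbT.
have cr : compact (cball x0 r).
  by apply: (compact_cball_sub cr0); rewrite mdistxx add0r ge_min lexx.
have [K x0K KA] := tdist_uniform x0.
have r4 : 0 < r / 4 by rewrite divr_gt0.
have [_ _ _ _ /(_ x0 v0)] := dil_A1 D.
have [[_ AU _ _] _] := dil_A0 D.
move=> /(_ (AU _ _ xv0))/cvg_mdistP/(_ _ r4) near_m.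
have [m [[[m1 mr] Km] mv0]] := filter_ex (filterI (filterI (filterI
  (at0_lt nu ltr01) (at0_lt nu r4)) (KA _ ltr01)) near_m).
have m0 := nu_gt0 nu m.
have mh : dil D m (f t) (h t) @[t --> F] --> dil D m x0 v0.
  apply: cvg_dil => //; first exact: cball_sub_dom (ltW m1) xv0.
  by apply: filterS fh => t; exact: cball_sub_dom (ltW m1).
have xmv0 : cball x0 A (dil D m x0 v0).
  by move: mv0 rA r4; rewrite /cball /=; lra.
have mg : \forall t \near F, cball x0 r (dil D m (f t) (g t)).
  near=> t.
  have : mdist (dil D m x0 v0) (dil D m (f t) (h t)) < r / 4.
    by near: t; move/cvg_mdistP : mh; apply.
  have : `|(nu m)^-1 * mdist (dil D m (f t) (g t)) (dil D m (f t) (h t))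
      - tdist D (f t) (g t) (h t)| < 1.
    by apply: Km; near: t => //; exact: fx0.
  have : `|tdist D (f t) (g t) (h t)| < 1.
    by near: t; move/cvgr0Pnorm_lt: gh0; apply.
  rewrite !ltr_norml => /andP[_ ?] /andP[_ ?] ?.
  have : (nu m)^-1 * mdist (dil D m (f t) (g t)) (dil D m (f t) (h t)) < 2 by lra.
  rewrite mulrC ltr_pdivrMr// => ?.
  have := metric_triangle x0 (dil D m x0 v0) (dil D m (f t) (g t)).
  have := metric_triangle (dil D m x0 v0) (dil D m (f t) (h t)) (dil D m (f t) (g t)).
  by rewrite (metric_sym (dil D m (f t) (h t))) /cball /=; lra.
pose proof (ultra_cvg FU cr mg) as [p xp mgp].
have fmA (k : T -> X) q : k @ F --> q -> mdist x0 q <= r ->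
    \forall t \near F, cball (f t) A (k t).
  by move=> kq x0q; apply: cvg_near_cball fx0 kq x0q _; lra.
have fmg := fmA _ _ mgp xp.
have fmh : \forall t \near F, cball (f t) A (dil D m (f t) (h t)).
  by apply: fmA mh _; lra.
pose proof (cvg_tdist fx0 mgp mh fmg fmh) as lim.
have p0 : tdist D x0 p (dil D m x0 v0) = 0.
  apply: (cvg_unique _ lim) => //.
  have : nu m * tdist D (f t) (g t) (h t) @[t --> F] --> (0 : R).
    by rewrite -(mulr0 (nu m)); exact: cvgMr.
  apply: cvg_eq_near; near=> t.
  by rewrite -tdist_dil //; near: t.
have [_ nd] := dil_A3 D.
have xpA : cball x0 A p by move: xp; rewrite /cball /=; lra.
have {nd}pE : p = dil D m x0 v0 by exact: nd xpA xmv0 p0.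
have [dv0 <-] := dilK (ltW m1) xv0.
have : dil D m^-1%g (f t) (dil D m (f t) (g t)) @[t --> F] -->
    dil D m^-1%g x0 (dil D m x0 v0).
  rewrite -pE in dv0 *; apply: cvg_dil => //.
  by apply: filterS fg => t /(dilK (ltW m1))[].
apply: cvg_eq_near; apply: filterS fg => t.
by case/(dilK (ltW m1)).
Unshelve. all: by end_near. Qed.

Lemma small_radius (K : set X) (Q : G -> X -> X -> X -> Prop) : compact K ->
    (forall (T : Type) (F : set_system T) (s : T -> G) (f g h : T -> X) x0,
      UltraFilter F -> s @ F --> at0 nu -> f @ F --> x0 -> g @ F --> x0 ->
      h @ F --> x0 -> \forall t \near F, Q (s t) (f t) (g t) (h t)) ->
  exists2 C : R, 0 < C & \forall e \near at0 nu, forall x u v,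
    K x -> cball x C u -> cball x C v -> Q e x u v.
Proof.
move=> cK HQ.
have [|[B C] /= [B0 [d /= d0 dC]] BC] := @near_ultra _ _
    (filter_prod (at0 nu) (0 : R)^'+) (fun p => local_triples K p.2)
    (fun p q => Q p.1 q.1.1 q.1.2 q.2).

  move=> F FU Fsr FK.
  have FF : ProperFilter F by exact: ultra_proper.
  have s0 : p.1.1 @[p --> F] --> at0 nu by exact: cvg_comp Fsr cvg_fst.
  have r0 : p.1.2 @[p --> F] --> (0 : R)^'+ by exact: cvg_comp Fsr cvg_snd.
  have [x0 _ fx0] : exists2 x0, K x0 & p.2.1.1 @[p --> F] --> x0.
    by apply: ultra_cvg => //; apply: filterS FK => p [].
  have lim (k : _ -> X) : (\forall p \near F, cball p.2.1.1 p.1.2 (k p)) ->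
      k @ F --> x0.
    move=> fk; apply: (cvg_mdist0 fx0).
    have r0' : p.1.2 @[p --> F] --> (0 : R).
      by apply: cvg_trans r0 _; exact: cvg_at_right_filter.
    apply: (squeeze_cvgr _ (cvg_cst 0) r0').
    by apply: filterS fk => p; rewrite /cball /= mdist_ge0.
  apply: (HQ _ F (fun p => p.1.1) (fun p => p.2.1.1) (fun p => p.2.1.2)
    (fun p => p.2.2) x0) => //; by apply: lim; apply: filterS FK => p [].
exists (d / 2); first by rewrite divr_gt0.
apply: filterS B0 => e Be x u v Kx xu xv.
apply: (BC (e, d / 2) _ (x, u, v)); last by split.
split=> //=; apply: dC => /=; last by rewrite divr_gt0.
by rewrite sub0r normrN gtr0_norm ?divr_gt0//; lra.
Qed.

Section ultra.
Context (T : Type) (F : set_system T) {FU : UltraFilter F}.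
Context (s : T -> G) (f g h : T -> X) (x0 : X).
Context (s0 : s @ F --> at0 nu) (fx0 : f @ F --> x0) (gx0 : g @ F --> x0)
  (hx0 : h @ F --> x0).

Let FF : ProperFilter F. Proof. exact: ultra_proper. Qed.

Let near_A (k l : T -> X) : k @ F --> x0 -> l @ F --> x0 ->
  \forall t \near F, cball (k t) A (l t).
Proof.
move=> kx0 lx0; apply: cvg_near_cball kx0 lx0 (@cballxx x0 0 _) _ => //.
exact: dilA_gt0.
Qed.

Let nu_lt1 : \forall t \near F, nu (s t) < 1.
Proof. exact: s0 _ (at0_lt nu ltr01). Qed.

Lemma Delta_dil : \forall t \near F,
  let z := dil D (s t) (f t) (g t) in
  let y := Delta_ D (s t) (f t) (g t) (h t) in
  cball z A y /\ dil D (s t) z y = dil D (s t) (f t) (h t).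
Proof.
have fg := near_A fx0 gx0; have fh := near_A fx0 hx0.
pose proof (cvg_tdist_dil s0 fx0 gx0 hx0 fg fh) as lim.
rewrite tdistxx in lim; last by apply: cballxx; exact/ltW/dilA_gt0.
rewrite /Delta_; near=> t; have s1 : nu (s t) < 1 by near: t.
have : `|(nu (s t))^-1 *
    mdist (dil D (s t) (f t) (g t)) (dil D (s t) (f t) (h t))| < 1.
  by near: t; move/cvgr0Pnorm_lt: lim; apply.
rewrite ger0_norm ?mulr_ge0 ?mdist_ge0 ?invr_ge0 ?(ltW (nu_gt0 _ _))//.
rewrite mulrC ltr_pdivrMr ?nu_gt0// mul1r => /(ball_sub_dil s1)[w zw <-].
have := zw.
by case/(dilK (ltW s1)) => _ ->.
Unshelve. all: by end_near. Qed.

Let z t := dil D (s t) (f t) (g t).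

Let zx0 : z @ F --> x0.
Proof. exact: cvg_dil_at0 s0 fx0 gx0 (near_A fx0 gx0). Qed.

Let cvg_dil_dil :
  (nu (s t))^-1 * mdist (f t) (dil D (s t) (z t) (h t)) @[t --> F] --> (0 : R).
Proof.
have xx0 : tdist D x0 x0 x0 = 0.
  by apply: tdistxx; apply: cballxx; exact/ltW/dilA_gt0.
pose proof (cvg_dil_base s0 fx0) as l1.
pose proof (cvg_tdist_dil s0 fx0 fx0 gx0 (near_A fx0 fx0) (near_A fx0 gx0)) as l2.
pose proof (cvg_dil_base s0 zx0) as l3.
pose proof (cvg_tdist_dil s0 zx0 zx0 hx0 (near_A zx0 zx0) (near_A zx0 hx0)) as l4.
rewrite xx0 in l2 l4.
pose proof (cvgD (cvgD l1 l2) (cvgD l3 l4)) as lim; rewrite !addr0 in lim.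
apply: (squeeze_cvgr _ (cvg_cst 0) lim); apply: nearW => t /=.
rewrite mulr_ge0 ?mdist_ge0 ?invr_ge0 ?(ltW (nu_gt0 _ _))//= -!mulrDr.
rewrite ler_pM2l ?invr_gt0 ?nu_gt0//.
have := metric_triangle (f t) (dil D (s t) (f t) (f t)) (z t).
have := metric_triangle (z t) (dil D (s t) (z t) (z t)) (dil D (s t) (z t) (h t)).
have := metric_triangle (f t) (z t) (dil D (s t) (z t) (h t)).
by rewrite /z !fctE; lra.
Qed.

Let Sigma_near : \forall t \near F,
  [/\ Sigma_defined nu D (s t) (f t) (g t) (h t),
      cball (f t) A (Sigma_ D (s t) (f t) (g t) (h t)) &
      dil D (s t) (f t) (Sigma_ D (s t) (f t) (g t) (h t)) =
        dil D (s t) (z t) (h t)].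
Proof.
rewrite /Sigma_defined /Sigma_ -/(z _); near=> t.
have s1 : nu (s t) < 1 by near: t.
have fg : cball (f t) A (g t) by near: t; exact: near_A.
have zh : cball (z t) A (h t) by near: t; exact: near_A.
have : `|(nu (s t))^-1 * mdist (f t) (dil D (s t) (z t) (h t))| < 1.
  by near: t; move/cvgr0Pnorm_lt: cvg_dil_dil; apply.
rewrite ger0_norm ?mulr_ge0 ?mdist_ge0 ?invr_ge0 ?(ltW (nu_gt0 _ _))//.
rewrite mulrC ltr_pdivrMr ?nu_gt0// mul1r => /(ball_sub_dil s1)[w fw wE].
rewrite -/(z t) -wE; have [dw ->] := dilK (ltW s1) fw; split=> //.
by split=> //; [exact: cball_sub_dom (ltW s1) fg|
  exact: cball_sub_dom (ltW s1) zh].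
Unshelve. all: by end_near. Qed.

Lemma cvg_Sigma : Sigma_ D (s t) (f t) (g t) (h t) @[t --> F] --> x0.
Proof.
pose y t := Sigma_ D (s t) (f t) (g t) (h t).
have fy : \forall t \near F, cball (f t) A (y t).
  by apply: filterS Sigma_near => t [].
have ff := near_A fx0 fx0.
apply: (cvg_of_tdist0 FU fx0 fx0 fy ff).
pose proof (cvgD cvg_dil_dil (cvg_dil_base s0 fx0)) as lim; rewrite addr0 in lim.
have lim1 : (nu (s t))^-1 * mdist (dil D (s t) (f t) (y t))
    (dil D (s t) (f t) (f t)) @[t --> F] --> (0 : R).
  apply: (squeeze_cvgr _ (cvg_cst 0) lim).
  apply: filterS Sigma_near => t [_ _ yE].
  rewrite mulr_ge0 ?mdist_ge0 ?invr_ge0 ?(ltW (nu_gt0 _ _))//= -mulrDr.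
  rewrite ler_pM2l ?invr_gt0 ?nu_gt0// yE fctE (metric_sym (f t)).
  exact: metric_triangle.
pose proof (cvgB lim1 (tdist_near s0 fx0 fy ff)) as lim2; rewrite subr0 in lim2.
by apply: cvg_eq_near lim2; apply: nearW => t /=; rewrite opprB addrC subrK.
Qed.

Lemma Sigma_dil (r : R) : 0 < r -> \forall t \near F,
  [/\ Sigma_defined nu D (s t) (f t) (g t) (h t),
      cball (f t) r (Sigma_ D (s t) (f t) (g t) (h t)) &
      dil D (s t) (f t) (Sigma_ D (s t) (f t) (g t) (h t)) =
        dil D (s t) (dil D (s t) (f t) (g t)) (h t)].
Proof.
move=> r0.
have fy : \forall t \near F, cball (f t) r (Sigma_ D (s t) (f t) (g t) (h t)).
  exact: cvg_near_cball fx0 cvg_Sigma (@cballxx x0 0 _) r0.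
by apply: filterS2 Sigma_near fy => t [].
Qed.

End ultra.

Lemma Delta_isometry x u v w p q : cball x A u -> cball x A v -> cball x A w ->
  (\forall e \near at0 nu, let z := dil D e x u in
    cball z A (Delta_ D e x u v) /\
    dil D e z (Delta_ D e x u v) = dil D e x v) ->
  (\forall e \near at0 nu, let z := dil D e x u in
    cball z A (Delta_ D e x u w) /\
    dil D e z (Delta_ D e x u w) = dil D e x w) ->
  Delta_ D e x u v @[e --> at0 nu] --> p ->
  Delta_ D e x u w @[e --> at0 nu] --> q ->
  tdist D x v w = tdist D x p q.
Proof.
move=> xu xv xw ve we vp wq.
have xF y : cball x A y -> \forall e \near at0 nu, cball x A y.
  by move=> ?; exact: nearW.
pose proof (cvg_dil_at0 cvg_id (cvg_cst x) (cvg_cst u) (xF _ xu)) as zx.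
pose proof (cvg_tdist_dil cvg_id (cvg_cst x) (cvg_cst _) (cvg_cst _)
  (xF _ xv) (xF _ xw)) as lim1.
have zv : \forall e \near at0 nu, cball (dil D e x u) A (Delta_ D e x u v).
  by apply: filterS ve => e [].
have zw : \forall e \near at0 nu, cball (dil D e x u) A (Delta_ D e x u w).
  by apply: filterS we => e [].
pose proof (cvg_tdist_dil cvg_id zx vp wq zv zw) as lim2.
apply: (cvg_unique _ lim1) => //; apply: cvg_eq_near lim2.
by apply: filterS2 ve we => e [_ /= ->] [_ /= ->].
Qed.
Lemma Sigma_cauchy (K : set X) : compact K -> exists2 C : R, 0 < C <= A / 2 &
  (\forall e \near at0 nu, forall x u v, K x -> cball x C u -> cball x C v ->
    [/\ Sigma_defined nu D e x u v, cball x A (Sigma_ D e x u v) &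
      dil D e x (Sigma_ D e x u v) = dil D e (dil D e x u) v]) /\
  (forall eta : R, 0 < eta -> \forall p \near filter_prod (at0 nu) (at0 nu),
    forall q, local_triples K C q ->
      mdist (uncurry3 (Sigma_ D p.1) q) (uncurry3 (Sigma_ D p.2) q) < eta).
Proof.
move=> cK; have A0 := dilA_gt0.
have [r1 r10 cr1] := compact_cball_uniform hX cK.
have [Delta /(_ K cK)[r2 r20 Deltar2]] := dil_A4 D.
pose QD e x u v := let z := dil D e x u in
  cball z A (Delta_ D e x u v) /\ dil D e z (Delta_ D e x u v) = dil D e x v.
have [r3 r30 Deltar3] : exists2 C : R, 0 < C & \forall e \near at0 nu,
    forall x u v, K x -> cball x C u -> cball x C v -> QD e x u v.
  by apply: small_radius => // T F s f g h x0 FU; exact: Delta_dil.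
pose r := Num.min (Num.min (r1 / 2) r2) (Num.min r3 (A / 2)).
have r0 : 0 < r by rewrite !lt_min r20 r30 !divr_gt0.
have [rr1 rr2 rr3 rA] : [/\ r <= r1 / 2, r <= r2, r <= r3 & r <= A / 2].
  by split; rewrite !ge_min lexx ?orbT.
pose QS e x u v := [/\ Sigma_defined nu D e x u v, cball x r (Sigma_ D e x u v) &
  dil D e x (Sigma_ D e x u v) = dil D e (dil D e x u) v].
have [C' C'0 SigmaC'] : exists2 C : R, 0 < C & \forall e \near at0 nu,
    forall x u v, K x -> cball x C u -> cball x C v -> QS e x u v.
  by apply: small_radius => // T F s f g h x0 FU s0 fx gx hx;
    exact: (Sigma_dil s0 fx gx hx r0).
pose C := Num.min C' r.
have C0 : 0 < C by rewrite lt_min C'0.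
have [CC' Cr] : C <= C' /\ C <= r by split; rewrite ge_min lexx ?orbT.
have sub (c c' : R) x y : c <= c' -> cball x c y -> cball x c' y.
  by move=> cc' /le_trans; apply.
have SigmaC : \forall e \near at0 nu,
    forall x u v, K x -> cball x C u -> cball x C v -> QS e x u v.
  by apply: filterS SigmaC' => e h x u v Kx xu xv; apply: h => //;
    apply: sub CC' _.
have iso x u v w : K x -> cball x r u -> cball x r v -> cball x r w ->
    tdist D x v w = tdist D x (Delta x u v) (Delta x u w).
  move=> Kx xu xv xw.
  have rA' : r <= A by lra.
  have near_D y : cball x r y -> \forall e \near at0 nu, QD e x u y.
    by move=> xy; apply: filterS Deltar3 => e h; apply: h => //; apply: sub rr3 _.
  have cvg_D y : cball x r y -> Delta_ D e x u y @[e --> at0 nu] --> Delta x u y.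
    move=> xy; apply/cvg_ballP => eps eps0.
    have := uniform_cvg_ball Deltar2 eps0; apply: filterS => e h.
    by apply: (h (x, u, y)); split=> //=; apply: sub rr2 _.
  by apply: (@Delta_isometry x u);
    do ?[exact: near_D|exact: cvg_D|exact: sub rA' _].
exists C; first by rewrite C0 (le_trans Cr).
split.
  apply: filterS SigmaC => e h x u v Kx xu xv; have [? + ?] := h x u v Kx xu xv.
  by move=> xS; split=> //; apply: sub xS; lra.
move=> eta eta0; apply: (@near_ultra _ _ _ (fun=> local_triples K C)).
move=> F FU Fsr FK; have FF : ProperFilter F by exact: ultra_proper.
have s0 : p.1.1 @[p --> F] --> at0 nu by exact: cvg_comp Fsr cvg_fst.
have s0' : p.1.2 @[p --> F] --> at0 nu by exact: cvg_comp Fsr cvg_snd.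
have [x0 Kx0 fx0] : exists2 x0, K x0 & p.2.1.1 @[p --> F] --> x0.
  by apply: ultra_cvg => //; apply: filterS FK => p [].
have lim (k : _ -> X) : (\forall p \near F, cball p.2.1.1 r (k p)) ->
    exists2 y, cball x0 r y & k @ F --> y.
  by apply: ultra_cvg_cball (cr1 _ Kx0) _ fx0; lra.
pose x := fun p : (G * G) * (X * X * X) => p.2.1.1.
pose u := fun p : (G * G) * (X * X * X) => p.2.1.2.
pose v := fun p : (G * G) * (X * X * X) => p.2.2.
have Kx : \forall p \near F, K (x p) by apply: filterS FK => p [].
have xu : \forall p \near F, cball (x p) C (u p) by apply: filterS FK => p [].
have xv : \forall p \near F, cball (x p) C (v p) by apply: filterS FK => p [].
have xur : \forall p \near F, cball (x p) r (u p).
  by apply: filterS xu => p; exact: sub.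
have xvr : \forall p \near F, cball (x p) r (v p).
  by apply: filterS xv => p; exact: sub.
have [v0 x0v0 vv0] := lim _ xvr; have [u0 x0u0 uu0] := lim _ xur.
have xuA : \forall p \near F, cball (x p) A (u p).
  by apply: filterS xur => p; apply: sub; lra.
have Sr (s : (G * G) * (X * X * X) -> G) : s @ F --> at0 nu ->
    \forall p \near F, QS (s p) (x p) (u p) (v p).
  move=> /(_ _ SigmaC) ss0.
  have h : \forall p \near F, forall x u v, K x -> cball x C u -> cball x C v ->
    QS (s p) x u v by exact: ss0.
  by apply: filterS3 h Kx (filterI xu xv) => p hp Kp [up vp]; exact: hp.
have Dv (s : (G * G) * (X * X * X) -> G) : s @ F --> at0 nu ->
    Delta (x p) (u p) (Sigma_ D (s p) (x p) (u p) (v p)) @[p --> F] --> v0.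
  move=> ss0; apply: (cvg_mdist0 vv0); apply/cvgr0Pnorm_lt => eps eps0.
  have ss1 := ss0 _ (uniform_cvg_ball Deltar2 eps0).
  have ss2 := ss0 _ (at0_lt nu ltr01).
  pose proof (cvg_dil_at0 ss0 fx0 uu0 xuA) as zx0.
  have zv : \forall p \near F, cball (dil D (s p) (x p) (u p)) A (v p).
    by apply: cvg_near_cball zx0 vv0 x0v0 _; lra.
  near=> p; rewrite ger0_norm ?mdist_ge0// metric_sym.
  have [_ xy yE] : QS (s p) (x p) (u p) (v p) by near: p; exact: Sr.
  have DE : Delta_ D (s p) (x p) (u p) (Sigma_ D (s p) (x p) (u p) (v p)) = v p.
    rewrite /Delta_ yE.
    have s1 : nu (s p) < 1 by near: p.
    by apply: (dilK (ltW s1) _).2; near: p.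
  rewrite -[X in mdist _ X]DE -ball_mdist.
  suff: forall q, local_triples K r2 q ->
      ball (uncurry3 Delta q) eps (uncurry3 (Delta_ D (s p)) q).
    move=> /(_ (x p, u p, Sigma_ D (s p) (x p) (u p) (v p))).
    apply; split => /=; [by near: p| |exact: sub rr2 xy].
    by apply: sub rr2 _; near: p.
  by near: p.
have Sr1 := Sr _ s0; have Sr2 := Sr _ s0'.
have [y2 x0y2 Sy2] : exists2 y, cball x0 r y &
    Sigma_ D p.1.2 (x p) (u p) (v p) @[p --> F] --> y.
  by apply: lim; apply: filterS Sr2 => p [].
have SA (k : _ -> X) : (\forall p \near F, cball (x p) r (k p)) ->
    \forall p \near F, cball (x p) A (k p).
  by apply: filterS => p; apply: sub; lra.
have tS : tdist D (x p) (Sigma_ D p.1.1 (x p) (u p) (v p))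
    (Sigma_ D p.1.2 (x p) (u p) (v p)) @[p --> F] --> (0 : R).
  have xv0 : cball x0 A v0 by apply: sub x0v0; lra.
  have DA (k : _ -> X) : k @ F --> v0 -> \forall p \near F, cball (x p) A (k p).
    by move=> kv0; apply: cvg_near_cball fx0 kv0 x0v0 _; lra.
  rewrite -(tdistxx xv0).
  have D1 := Dv _ s0; have D2 := Dv _ s0'.
  apply: cvg_eq_near (cvg_tdist fx0 D1 D2 (DA _ D1) (DA _ D2)).
  near=> p; have [_ S1 _] : QS p.1.1 (x p) (u p) (v p) by near: p.
  have [_ S2 _] : QS p.1.2 (x p) (u p) (v p) by near: p.
  by rewrite -iso //; near: p.
have S1A : \forall p \near F, cball (x p) A (Sigma_ D p.1.1 (x p) (u p) (v p)).
  by apply: SA; apply: filterS Sr1 => p [].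
have S2A : \forall p \near F, cball (x p) A (Sigma_ D p.1.2 (x p) (u p) (v p)).
  by apply: SA; apply: filterS Sr2 => p [].
pose proof (cvg_of_tdist0 FU fx0 Sy2 S1A S2A tS) as Sy1.
pose proof (cvg_mdist Sy1 Sy2) as dS; rewrite mdistxx in dS.
move/cvgr0Pnorm_lt: dS => /(_ _ eta0); apply: filterS => p.
by rewrite ger0_norm ?mdist_ge0.
Unshelve. all: by end_near. Qed.

Lemma Sigma_isometry x u v w p q :
  cball x A u -> mdist x v < A -> mdist x w < A ->
  (\forall e \near at0 nu, cball x A (Sigma_ D e x u v) /\
    dil D e x (Sigma_ D e x u v) = dil D e (dil D e x u) v) ->
  (\forall e \near at0 nu, cball x A (Sigma_ D e x u w) /\
    dil D e x (Sigma_ D e x u w) = dil D e (dil D e x u) w) ->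
  Sigma_ D e x u v @[e --> at0 nu] --> p ->
  Sigma_ D e x u w @[e --> at0 nu] --> q ->
  tdist D x p q = tdist D x v w.
Proof.
move=> xu xv xw ve we vp wq.
have xuF : \forall e \near at0 nu, cball x A u by exact: nearW.
pose proof (cvg_dil_at0 cvg_id (cvg_cst x) (cvg_cst u) xuF) as zx.
have zF y : mdist x y < A -> \forall e \near at0 nu, cball (dil D e x u) A y.
  by move=> xy; apply: cvg_near_cball zx (cvg_cst y) (lexx _) xy.
pose proof (cvg_tdist_dil cvg_id zx (cvg_cst _) (cvg_cst _) (zF _ xv) (zF _ xw))
  as lim1.
have Sv : \forall e \near at0 nu, cball x A (Sigma_ D e x u v).
  by apply: filterS ve => e [].
have Sw : \forall e \near at0 nu, cball x A (Sigma_ D e x u w).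
  by apply: filterS we => e [].
pose proof (cvg_tdist_dil cvg_id (cvg_cst x) vp wq Sv Sw) as lim2.
apply: (cvg_unique _ lim2) => //; apply: cvg_eq_near lim1.
by apply: filterS2 ve we => e [_ /= ->] [_ /= ->].
Qed.

End dilatation.

Unset Implicit Arguments.
Set Strict Implicit.

Theorem corollary9 (G : topologicalComGroupType) (R : realType)
  (nu : scale G R) (X : completeMetricType R)
  (D : dilatation_structure nu X)
  (hG : hausdorff_space G)
  (hX : locally_compact [set: X])
  (hd : forall x : X, tdist_nondegenerate D x) :
  exists Sigma : X -> X -> X -> X,
    forall K : set X, compact K -> exists2 C : R, 0 < C <= dilA D &
      [/\ \forall e \near at0 nu, forall x u v : X,
            K x -> cball x C u -> cball x C v -> Sigma_defined nu D e x u v,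
          {uniform local_triples K C,
            (fun e => uncurry3 (Sigma_ D e)) @ at0 nu --> uncurry3 Sigma} &
          forall x u : X, K x -> mdist x u <= C ->
            tdist_isometry_on D x (cball x C) (Sigma x u)].
Proof.
pose Sigma x u v := xget x [set y | Sigma_ D e x u v @[e --> at0 nu] --> y].
exists Sigma => K cK; have A0 := dilA_gt0 D.
have [C /andP[C0 CA] [nearS cauS]] := Sigma_cauchy D hX cK.
have SigmaP x u v : K x -> cball x C u -> cball x C v ->
    Sigma_ D e x u v @[e --> at0 nu] --> Sigma x u v.
  move=> Kx xu xv; suff : cvg (Sigma_ D e x u v @[e --> at0 nu]).
    move=> /cvg_ex[y yS].
    exact: (@xgetPex _ x [set y | Sigma_ D e x u v @[e --> at0 nu] --> y])
      (ex_intro _ y yS).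
  apply/cauchy_cvgP; apply: cauchy_exP => eps eps0.
  have [[B B'] /= [HB HB'] BB'] := cauS _ eps0.
  have [e Be] := filter_ex HB; exists (Sigma_ D e x u v).
  apply: filterS HB' => e' Be'; rewrite /= ball_mdist.
  exact: (BB' (e, e') _ (x, u, v)).
have CA' : C < dilA D by lra.
have xA x y : cball x C y -> mdist x y < dilA D.
  by move=> xy; exact: le_lt_trans xy CA'.
exists C; first by rewrite C0 ltW.
split.
- by apply: filterS nearS => e h x u v Kx xu xv; case: (h x u v Kx xu xv).
- apply: ball_uniform_cvg => eps eps0.
  have e2 : 0 < eps / 2 by rewrite divr_gt0.
  have [[B B'] /= [HB HB'] BB'] := cauS _ e2.
  apply: filterS HB => e Be q Kq; rewrite ball_mdist metric_sym.
  have /= lim := SigmaP q.1.1 q.1.2 q.2; case: (Kq) => Kx xu xv.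
  pose proof (cvg_mdist (cvg_cst (uncurry3 (Sigma_ D e) q)) (lim Kx xu xv)) as lim1.
  apply: (@le_lt_trans _ _ (eps / 2)); last by lra.
  apply: (cvgr_to_le lim1); apply: filterS HB' => e' Be'; apply/ltW.
  exact: (BB' (e, e')) Kq.
- move=> x u Kx xu.
  have near_x v : cball x C v -> \forall e \near at0 nu,
      cball x (dilA D) (Sigma_ D e x u v) /\
      dil D e x (Sigma_ D e x u v) = dil D e (dil D e x u) v.
    by move=> xv; apply: filterS nearS => e h; case: (h x u v Kx xu xv).
  split=> [v xv|v w xv xw].
    apply: (cvg_cball (cvg_cst x) (SigmaP x u v Kx xu xv)).
    by apply: filterS (near_x v xv) => e [].
  apply: (@Sigma_isometry _ _ nu _ D hX x u) => //;
    do ?[exact: near_x|exact: xA|exact: SigmaP].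
  exact/ltW/xA.
Qed.
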